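(* There are no 6-vertex-critical ($P_6$, diamond)-free graphs with clique number $4$.
   Context: All graphs are finite and simple. $P_n$ and $K_n$ denote the path and the complete graph on $n$ vertices. The diamond is the graph obtained from $K_4$ by removing an edge. A graph $G$ contains a graph $H$ if some induced subgraph of $G$ is isomorphic to $H$; $G$ is $(H_1,\ldots,H_n)$-free if it contains none of $H_1,\ldots,H_n$. The clique number of $G$ is the size of a largest clique in $G$, and $\chi(G)$ is the chromatic number. A graph $G$ is $k$-vertex-critical if $\chi(G)=k$ and every proper induced subgraph of $G$ has chromatic number smaller than $k$. *)

(* Defs.v *)
From Stdlib Require List.
From mathcomp Require Import all_boot.

Set Implicit Arguments.
Unset Strict Implicit.
Unset Printing Implicit Defensive.

Record sgraph := SGraph {
  vertex :> finType;
  adj : rel vertex;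
  adj_sym : symmetric adj;
  adj_irrefl : irreflexive adj
}.

Section Induced.
Variables (G : sgraph) (A : {set G}).

Definition induced_adj : rel {x : G | x \in A} :=
  fun x y => adj (val x) (val y).

Lemma induced_sym : symmetric induced_adj.
Proof. by move=> x y; apply: adj_sym. Qed.

Lemma induced_irrefl : irreflexive induced_adj.
Proof. by move=> x; apply: adj_irrefl. Qed.

Definition induced : sgraph := SGraph induced_sym induced_irrefl.
End Induced.

Definition isomorphic (G H : sgraph) : Prop :=
  exists2 f : G -> H, bijective f & forall x y, adj (f x) (f y) = adj x y.

Definition contains (G H : sgraph) : Prop :=
  exists A : {set G}, isomorphic H (induced A).

Definition free (Hs : seq sgraph) (G : sgraph) : Prop :=
  List.Forall (fun H => ~ contains G H) Hs.

Definition is_clique (G : sgraph) (A : {set G}) : bool :=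
  [forall x in A, forall y in A, (x != y) ==> adj x y].

Definition clique_number (G : sgraph) : nat :=
  \max_(A : {set G} | is_clique A) #|A|.

Definition colorable (G : sgraph) (k : nat) : bool :=
  [exists c : {ffun G -> 'I_k}, forall x, forall y, adj x y ==> (c x != c y)].

Lemma colorable_card (G : sgraph) : exists k, colorable G k.
Proof.
exists #|G|; apply/existsP; exists [ffun x => enum_rank x].
apply/forallP => x; apply/forallP => y; apply/implyP => xy.
rewrite !ffunE (inj_eq enum_rank_inj).
by apply: contraTneq xy => ->; rewrite adj_irrefl.
Qed.

Definition chromatic_number (G : sgraph) : nat := ex_minn (colorable_card G).

Definition vertex_critical (k : nat) (G : sgraph) : Prop :=
  chromatic_number G = k /\
  forall A : {set G}, A \proper [set: G] -> chromatic_number (induced A) < k.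

Section PathGraph.
Variable n : nat.

Definition path_adj : rel 'I_n :=
  fun i j => (i.+1 == j :> nat) || (j.+1 == i :> nat).

Lemma path_sym : symmetric path_adj.
Proof. by move=> i j; rewrite /path_adj orbC. Qed.

Lemma path_irrefl : irreflexive path_adj.
Proof. by move=> i; rewrite /path_adj orbb gtn_eqF. Qed.

Definition path_graph : sgraph := SGraph path_sym path_irrefl.
End PathGraph.

Section CompleteGraph.
Variable n : nat.

Definition complete_adj : rel 'I_n := fun i j => i != j.

Lemma complete_sym : symmetric complete_adj.
Proof. by move=> i j; rewrite /complete_adj eq_sym. Qed.

Lemma complete_irrefl : irreflexive complete_adj.
Proof. by move=> i; rewrite /complete_adj eqxx. Qed.

Definition complete_graph : sgraph := SGraph complete_sym complete_irrefl.
End CompleteGraph.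

Section RemoveEdge.
Variables (G : sgraph) (a b : G).

Definition remove_edge_adj : rel G :=
  fun x y => adj x y && ~~ ((x == a) && (y == b) || (x == b) && (y == a)).

Lemma remove_edge_sym : symmetric remove_edge_adj.
Proof.
by move=> x y; rewrite /remove_edge_adj adj_sym orbC ![(y == _) && _]andbC.
Qed.

Lemma remove_edge_irrefl : irreflexive remove_edge_adj.
Proof. by move=> x; rewrite /remove_edge_adj adj_irrefl. Qed.

Definition remove_edge : sgraph := SGraph remove_edge_sym remove_edge_irrefl.
End RemoveEdge.

Definition diamond : sgraph :=
  @remove_edge (complete_graph 4) (ord0 : 'I_4) (ord_max : 'I_4).

(* Main.v *)
(* Grow an induced subgraph H of G, starting from a K4. The type of a vertex
   outside H is its neighbourhood in H; since G is (P6, diamond, K5)-free, only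
   few types are possible, and they are updated as H grows. Criticality demands
   outside vertices: a vertex with fewer than 5 neighbours in H has another one
   outside, and if N_H(u) is contained in N_H(v) for nonadjacent u and v, then
   some outside vertex is adjacent to u but not to v. Branch on the types that
   meet the smallest demand. In each branch either some demand is met by no
   possible type, or no demand is left. In the latter case, H and its nonempty
   types turn out to have a 5-colouring in which vertices that may be adjacent
   always get different colours. The vertices of empty type have no neighbour of
   another type, and by criticality they induce a 5-colourable graph, so G is
   5-colourable, a contradiction. The search tree is small enough to be explored
   by computation. *)
Require Import Defs.
From mathcomp Require Import all_boot.

Set Implicit Arguments.
Unset Strict Implicit.
Unset Printing Implicit Defensive.

(** * Induced paths, diamonds and cliques in lists of vertices *)

Section Patterns.
Variables (T : eqType) (e : rel T).

Fixpoint induced_path (p : seq T) : bool :=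
  if p is x :: q then
    (if q is y :: r then e x y && all (fun z => ~~ e x z) r else true)
      && induced_path q
  else true.

(** Looks for an induced path that starts at [x] and continues with [k] vertices of [C]. All
    vertices after [w] must avoid the neighbours of [x], hence [C']. *)
Fixpoint arm (k : nat) (x : T) (C : seq T) : bool :=
  if k is k'.+1 then
    let C' := [seq w <- C | ~~ e x w] in
    has (fun w => arm k' w C') [seq w <- C | e x w]
  else true.

(** Up to reversal of the path, [y] is its first, second or third vertex; [a] and [b] are the
    vertices before it. *)
Definition path6_at (y : T) (V : seq T) : bool :=
  arm 5 y V ||
  has (fun a =>
    let Va := [seq w <- V | ~~ e a w] in
    arm 4 y Va ||
    has (fun b => arm 3 y [seq w <- Va | ~~ e b w])
      [seq b <- V | e a b && ~~ e y b])
    [seq a <- V | e y a].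

(** The vertex [y] has degree 3 in the diamond if [w] is in [N], and degree 2 if [w] is in [M]. *)
Definition diamond_at (y : T) (V : seq T) : bool :=
  let N := [seq w <- V | e y w] in
  let M := [seq w <- V | ~~ e y w] in
  has (fun c => has (fun d =>
      has (fun w => [&& w != c, e d w & ~~ e c w]) N ||
      has (fun w => e c w && e d w) M)
    [seq d <- N | e c d]) N.

Fixpoint clique_in (k : nat) (C : seq T) : bool :=
  if k is k'.+1 then has (fun w => clique_in k' [seq z <- C | e w z]) C
  else true.

Lemma arm_path k x C : arm k x C ->
  exists q, [/\ size q = k, {subset q <= C} & induced_path (x :: q)].
Proof.
elim: k x C => [|k IHk] x C /=; first by exists [::].
case/hasP=> w; rewrite mem_filter => /andP[xw wC] /IHk[q [sz_q qC path_q]].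
exists (w :: q); split; first by rewrite /= sz_q.
- move=> z /predU1P[-> // | /qC]; by rewrite mem_filter => /andP[].
- rewrite xw path_q andbT; apply/allP=> z /qC.
  by rewrite mem_filter => /andP[].
Qed.

Lemma clique_in_pairwise k C : clique_in k C ->
  exists q, [/\ size q = k, {subset q <= C} & pairwise e q].
Proof.
elim: k C => [|k IHk] C /=; first by exists [::].
case/hasP=> w wC /IHk[q [sz_q qC cl_q]].
exists (w :: q); split=> /=; first by rewrite sz_q.
- move=> z /predU1P[-> // | /qC]; by rewrite mem_filter => /andP[].
- by rewrite cl_q andbT; apply/allP=> z /qC; rewrite mem_filter => /andP[].
Qed.

Hypothesis e_sym : symmetric e.

Lemma path6_atP y V : path6_at y V ->
  exists p, [/\ size p = 6, {subset p <= y :: V} & induced_path p].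
Proof.
have sub_cons (q C : seq T) : {subset C <= V} -> {subset q <= C} ->
    {subset y :: q <= y :: V}.
  move=> CV qC z; rewrite !in_cons => /predU1P[-> | /qC/CV ->].
    by rewrite eqxx.
  exact: orbT.
have sub_filter a (s : seq T) : {subset [seq z <- s | a z] <= s}.
  by move=> z; rewrite mem_filter => /andP[].
rewrite /path6_at => /orP[/arm_path[q [sz_q qV path_q]] | /hasP[a]].
  by exists (y :: q); rewrite /= sz_q; split=> //; apply: sub_cons qV.
rewrite mem_filter => /andP[ya aV].
case/orP=> [/arm_path[q [sz_q qV path_q]] | /hasP[b]].
  exists (a :: y :: q); rewrite /= sz_q; split=> //.
    move=> z; rewrite in_cons => /predU1P[-> | ]; first by rewrite inE aV orbT.
    exact: (sub_cons _ _ (sub_filter _ _) qV).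
  rewrite e_sym ya -[_ && induced_path q]/(induced_path (y :: q)) path_q andbT.
  by apply/allP=> z /qV; rewrite mem_filter => /andP[].
rewrite mem_filter => /andP[/andP[ab yNb] bV] /arm_path[q [sz_q qV path_q]].
exists (b :: a :: y :: q); rewrite /= sz_q; split=> //.
  move=> z; rewrite in_cons => /predU1P[-> | ]; first by rewrite inE bV orbT.
  rewrite in_cons => /predU1P[-> | ]; first by rewrite inE aV orbT.
  by apply: (sub_cons _ _ _ qV) => w /sub_filter/sub_filter.
rewrite e_sym ab (e_sym b) yNb (e_sym a) ya.
rewrite -[_ && induced_path q]/(induced_path (y :: q)) path_q andbT /=.
by apply/andP; split; apply/allP=> z /qV; rewrite !mem_filter => /and3P[].
Qed.

Lemma diamond_atP y V : y \notin V -> diamond_at y V ->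
  exists a b c d, {subset [:: a; b; c; d] <= y :: V} /\
    [/\ a != b, ~~ e a b, e c d & [&& e a c, e a d, e b c & e b d]].
Proof.
move=> yV /hasP[c]; rewrite mem_filter => /andP[yc cV] /hasP[d].
rewrite !mem_filter => /and3P[cd yd dV] /orP[] /hasP[w].
  rewrite mem_filter => /andP[yw wV] /and3P[wc dw cNw].
  exists c, w, y, d; split.
    by apply/allP; rewrite /= !inE eqxx cV wV dV !orbT.
  by rewrite eq_sym wc cNw yd cd e_sym yc (e_sym w) yw (e_sym w) dw.
rewrite mem_filter => /andP[yw wV] /andP[cw dw].
exists y, w, c, d; split.
  by apply/allP; rewrite /= !inE eqxx cV wV dV !orbT.
rewrite yw cd yc yd e_sym cw e_sym dw; split=> //.
by apply: contraNneq yV => ->.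
Qed.

End Patterns.

(** * Coded graphs, types, demands and the search *)

(* A graph is coded by the triangle of its adjacency matrix: the row of a vertex
   lists its adjacency to the older vertices. Rows and entries are both ordered
   newest first, so vertex 0 is the newest one and prepending a row adds a vertex. *)
Fixpoint edge (H : seq (seq bool)) (i j : nat) : bool :=
  match H, i, j with
  | t :: _, 0, j'.+1 => nth false t j'
  | t :: _, i'.+1, 0 => nth false t i'
  | _ :: H', i'.+1, j'.+1 => edge H' i' j'
  | _, _, _ => false
  end.

(* The forbidden configurations sought are those through the newest vertex. *)
Definition bad (H : seq (seq bool)) : bool :=
  let V := iota 1 (size H).-1 in
  [|| diamond_at (edge H) 0 V,
      clique_in (edge H) 4 [seq w <- V | edge H 0 w]
    | path6_at (edge H) 0 V].

(** The new bit [b] is the adjacency to the added vertex of type [s]. The type [s] itself is kept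
    among the [t], since other outside vertices may share it. *)
Definition next (s : seq bool) (H ext : seq (seq bool)) : seq (seq bool) :=
  [seq u <- [seq b :: t | t <- ext, b <- [:: true; false]]
     | ~~ bad (u :: s :: H)].

Definition row (H : seq (seq bool)) (i : nat) : seq bool :=
  [seq edge H i j | j <- iota 0 (size H)].

Definition dominated (H : seq (seq bool)) (i j : nat) : bool :=
  [&& ~~ edge H i j, i != j & all2 implb (row H i) (row H j)].

(** A demand is coded by the list of possible types that meet it, so an empty list is a
    contradiction. *)
Definition demands (H ext : seq (seq bool)) : seq (seq (seq bool)) :=
  let V := iota 0 (size H) in
  [seq [seq t <- ext | nth false t i] | i <- V & count id (row H i) < 5] ++
  [seq [seq t <- ext | nth false t i && ~~ nth false t j]
     | i <- V, j <- [seq j <- V | dominated H i j]].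

(** Left items are vertices of [H], right items are types. Two types conflict if outside vertices of
    these types may be adjacent. *)
Definition conflict (H : seq (seq bool)) (a b : nat + seq bool) : bool :=
  match a, b with
  | inl i, inl j => edge H i j
  | inl i, inr t | inr t, inl i => nth false t i
  | inr t, inr t' => ~~ bad ((true :: t) :: t' :: H)
  end.

Section Colour.
Variables (T : eqType) (e : rel T).

(* [find] and [if] stop early under [vm_compute], [has] and [&&] do not. *)
Fixpoint colour (s : seq T) (L : seq (T * nat)) : bool :=
  if s is x :: s' then
    find (fun c =>
      if all (fun p => if p.2 == c then ~~ e x p.1 else true) L
      then colour s' ((x, c) :: L) else false) (iota 0 5) < 5
  else true.
End Colour.

(** The tests on [E] make each nonempty type an independent set without edges to the vertices of
    empty type. By [rev], the colouring starts with the oldest vertices, those of the K4. *)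
Definition closes (H ext : seq (seq bool)) : bool :=
  let E := [seq t <- ext | has id t] in
  let n := size H in
  [&& 0 < n, all (fun t => ~~ conflict H (inr t) (inr t)) E,
      all (fun t => ~~ conflict H (inr t) (inr (nseq n false))) E
    & colour (conflict H)
        ([seq inl i | i <- rev (iota 0 n)] ++ [seq inr t | t <- E]) [::]].

(* Sorting only serves the running time: any demand would do. *)
Fixpoint search (fuel : nat) (H ext : seq (seq bool)) : bool :=
  if fuel is f.+1 then
    match sort (fun a b => size a <= size b) (demands H ext) with
    | [::] => closes H ext
    | [::] :: _ => true
    | (s :: _) :: _ =>
      if search f (s :: H) (next s H ext)
      then search f H [seq t <- ext | t != s] else false
    end
  else false.

Fixpoint clique_rows (n : nat) : seq (seq bool) :=
  if n is n'.+1 then nseq n' true :: clique_rows n' else [::].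

Fixpoint clique_types (n : nat) : seq (seq bool) :=
  if n is n'.+1 then next (nseq n' true) (clique_rows n') (clique_types n')
  else [:: [::]].

Lemma edge_sym H : symmetric (edge H).
Proof. by elim: H => [|t H IHH] [|i] [|j] //=. Qed.

Lemma edge_irrefl H : irreflexive (edge H).
Proof. by elim: H => [|t H IHH] [|i] //=. Qed.

(** * From patterns to induced subgraphs *)

Section Embedding.
Variable G : sgraph.

Lemma embedding_contains (H : sgraph) (f : H -> G) :
  injective f -> (forall x y, adj (f x) (f y) = adj x y) -> contains G H.
Proof.
move=> f_inj f_adj; exists (f @: [set: H]).
pose g x : {y | y \in f @: [set: H]} := Sub (f x) (imset_f f (in_setT x)).
exists g => [|x y]; last exact: f_adj.
apply: inj_card_bij; first by move=> x y /(congr1 val)/f_inj.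
by rewrite card_sig -cardsT card_imset.
Qed.

Lemma induced_path_nth (x0 : G) p i j : induced_path (@adj G) p ->
  i < size p -> j < size p ->
  adj (nth x0 p i) (nth x0 p j) = (i.+1 == j) || (j.+1 == i).
Proof.
elim: p i j => [|x q IHq] //= i j /andP[xq path_q].
have x_nth k : k < size q -> adj x (nth x0 q k) = (k == 0).
  case: q xq {IHq path_q} => [|y r] //= /andP[xy /allP xr].
  by case: k => [|k] //= kr; apply/negbTE/xr/mem_nth.
case: i j => [|i] [|j] //=; rewrite ?adj_irrefl ?eqSS // ltnS => *.
- by rewrite x_nth // orbF eq_sym.
- by rewrite adj_sym x_nth // eq_sym.
- exact: IHq.
Qed.

(** [induced_path] does not ask for distinct vertices. For six entries distinctness follows, because
    no two vertices of the path on six vertices have the same neighbours; this is checked by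
    computation. *)
Lemma P6_free_path (p : seq G) :
  ~ contains G (path_graph 6) -> size p = 6 -> ~~ induced_path (@adj G) p.
Proof.
move=> P6f sz_p; apply/negP => path_p; apply: P6f.
have [x0 _] : exists x0, x0 \in p.
  by case: p sz_p {path_p} => // x; exists x; rewrite mem_head.
pose f (i : 'I_6) := nth x0 p i.
have f_adj i j : adj (f i) (f j) = @path_adj 6 i j.
  by apply: induced_path_nth; rewrite ?sz_p.
apply: (@embedding_contains (path_graph 6) f) => // i j fij.
pose P i j := (i.+1 == j) || (j.+1 == i).
pose I := iota 0 6.
have: all (fun i =>
    all (fun j => (i == j) || has (fun k => P i k != P j k) I) I) I.
  by [].
have mem_I (k : 'I_6) : (k : nat) \in I by rewrite mem_iota ltn_ord.
move=> /allP/(_ _ (mem_I i))/allP/(_ _ (mem_I j))/orP[/eqP/val_inj // |].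
case/hasP=> k; rewrite mem_iota => /= k6 /eqP[]; have := f_adj i (Ordinal k6).
by rewrite fij f_adj /path_adj /P /= => ->.
Qed.

Lemma diamond_free_adj (a b c d : G) : ~ contains G diamond ->
  a != b -> adj c d -> adj a c -> adj a d -> adj b c -> adj b d -> adj a b.
Proof.
move=> df ab cd ac ad bc bd; apply: contra_notT df => aNb.
(* The nonadjacent [a] and [b] take positions 0 and 3, the ends of the edge removed from K4. *)
pose f (i : 'I_4) := nth a [:: a; c; d; b] i.
have neq x y : adj x y -> x != y.
  by apply: contraTneq => ->; rewrite adj_irrefl.
have uq : uniq [:: a; c; d; b].
  by rewrite /= !inE !negb_or ab !neq ?(adj_sym c) // adj_sym.
apply: (@embedding_contains diamond f) => [i j /eqP|].
  by rewrite nth_uniq //; move/eqP/val_inj.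
move=> [[|[|[|[|//]]]] ?] [[|[|[|[|//]]]] ?];
rewrite /f /= /remove_edge_adj /= /complete_adj -?val_eqE /= ?adj_irrefl //.
all: by rewrite // ?(negbTE aNb) // adj_sym // (negbTE aNb).
Qed.

End Embedding.

(** * Correctness of the colouring procedure *)

Section Colouring.
Variables (T : eqType) (e : rel T).

(** [colour] tests [e] only from the later item to the earlier one, and [e] need not be symmetric;
    so colours are known to differ only where [e] holds both ways. *)
Lemma colour_pairs s (L : seq (T * nat)) :
    let valid (L : seq (T * nat)) := all (fun p => p.2 < 5) L /\
      {in L &, forall p q, p != q -> e p.1 q.1 -> e q.1 p.1 -> p.2 != q.2} in
  colour e s L -> valid L ->
  exists L', [/\ valid L', {subset s <= unzip1 L'} & {subset L <= L'}].
Proof.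
move=> valid; elim: s L => [|x s IHs] L.
  by move=> _ validL; exists L; split.
rewrite -[colour _ _ _]/(find _ (iota 0 5) < size (iota 0 5)) -has_find.
case/hasP=> c.
rewrite mem_iota => c5; case: ifP => // /allP Lx /IHs{}IHs [L5 validL].
have Lc p : p \in L -> e x p.1 -> p.2 != c.
  by move=> /Lx /=; case: eqP => // _ /negP.
case: IHs => [|L' [validL' sL' LL']].
  split=> [|p q]; first by rewrite /= L5 andbT.
  rewrite !in_cons => /predU1P[->|pL] /predU1P[->|qL] //=; first by rewrite eqxx.
  - by move=> _ xq _; rewrite eq_sym Lc.
  - by move=> _ _ xp; rewrite Lc.
  - exact: validL.
exists L'; split=> // [z|z zL]; last by rewrite LL' // in_cons zL orbT.
rewrite in_cons => /predU1P[->|/sL' //].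
by apply/mapP; exists (x, c); rewrite ?LL' ?mem_head.
Qed.

Lemma colour_fun s : colour e s [::] ->
  exists phi : T -> nat, {in s, forall a, phi a < 5} /\
    {in s &, forall a b, a != b -> e a b -> e b a -> phi a != phi b}.
Proof.
case/colour_pairs=> // L [[/allP L5 validL] sL _].
(* An item may occur in several pairs of [L]; the first one is taken. The default is never reached
   on [s]. *)
pose phi a := (head (a, 0) [seq p <- L | p.1 == a]).2.
have phiL a : a \in s -> (a, phi a) \in L.
  move=> /sL/mapP[p pL ap]; rewrite /phi.
  have : p \in [seq p <- L | p.1 == a] by rewrite mem_filter ap eqxx.
  have : all (mem L) [seq p <- L | p.1 == a].
    by apply/allP=> q; rewrite mem_filter => /andP[].
  have : all (fun p => p.1 == a) [seq p <- L | p.1 == a] by apply: filter_all.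
  by case: [seq p <- L | p.1 == a] => [|[b c] r] //= /andP[/eqP-> _] /andP[].
exists phi; split=> [a /phiL/L5 // | a b aS bS ab eab eba].
apply: (validL _ _ (phiL a aS) (phiL b bS)) => //.
by apply: contraNneq ab => -[->].
Qed.
End Colouring.

(** * Cliques as lists of pairwise adjacent vertices *)

Section Cliques.
Variable G : sgraph.

Lemma pairwise_clique (q : seq G) :
  pairwise (@adj G) q -> size q <= clique_number G.
Proof.
move=> cl_q; have uq := pairwise_uniq (@adj_irrefl G) cl_q.
rewrite -(card_uniqP uq) -cardsE; apply: leq_bigmax_cond.
(* The reflexive closure of adjacency can be passed from ordered pairs of entries to all pairs. *)
pose r : rel G := fun x y => (x == y) || adj x y.
have : pairwise r q.
  by apply: sub_pairwise cl_q => x y xy; rewrite /r xy orbT.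
rewrite pairwise_all2rel; first last.
- by move=> x y; rewrite /r eq_sym adj_sym.
- by move=> x; rewrite /r eqxx.
move=> /allrelP clq; apply/forall_inP=> x xq; apply/forall_inP=> y yq.
rewrite !inE in xq yq; apply/implyP=> xy.
by have := clq x y xq yq; rewrite /r (negbTE xy).
Qed.

Lemma clique_number_pairwise :
  exists2 q, size q = clique_number G & pairwise (@adj G) q.
Proof.
have cl0 : is_clique (set0 : {set G}) by apply/forall_inP=> x; rewrite inE.
have [|A clA maxA] := @eq_bigmax_cond _ (@is_clique G) (fun A => #|A|).
  by apply/card_gt0P; exists set0.
exists (enum A); first by rewrite -cardE; apply/esym/maxA.
have := enum_uniq A; rewrite uniq_pairwise.
apply: (@sub_in_pairwise _ (mem A)).
  move=> x y xA yA /=.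
  by apply/implyP/(forall_inP (forall_inP clA x xA) y yA).
by apply/allP=> x; rewrite mem_enum.
Qed.
End Cliques.

(** * Five-colourings from criticality *)

Section Critical.
Variable G : sgraph.
Hypothesis critG : vertex_critical 6 G.

Lemma colorable_leq (H : sgraph) m n :
  m <= n -> colorable H m -> colorable H n.
Proof.
move=> mn /existsP[c /forallP col_c]; apply/existsP.
exists [ffun x => widen_ord mn (c x)]; apply/forallP=> x; apply/forallP=> y.
rewrite !ffunE; exact: (forallP (col_c x) y).
Qed.

Lemma critical_not_5colorable (c : G -> 'I_5) :
  ~ (forall x y, adj x y -> c x != c y).
Proof.
move=> col_c; case: critG => [chi6 _].
have : colorable G 5.
  apply/existsP; exists [ffun x => c x]; apply/forallP=> x; apply/forallP=> y.
  by rewrite !ffunE; apply/implyP/col_c.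
move: chi6; rewrite /chromatic_number; case: ex_minnP => m _ min_m m6 /min_m.
by rewrite m6.
Qed.

Lemma critical_coloring (A : {set G}) : A != setT ->
  exists c : G -> 'I_5, {in A &, forall x y, adj x y -> c x != c y}.
Proof.
rewrite -properT => /(proj2 critG).
rewrite /chromatic_number; case: ex_minnP => m col_m _; rewrite ltnS => m5.
have /existsP[c /forallP col_c] := colorable_leq m5 col_m.
exists (fun x => if insub x is Some u then c u else ord0) => x y xA yA xy.
rewrite !insubT /=; exact: (implyP (forallP (col_c _) _)).
Qed.

(** A colour missing among the neighbours of [u] could be given to [u], which would make [G]
    5-colourable. *)
Lemma critical_recolor (u : G) : exists c : G -> 'I_5,
  {in [set~ u] &, forall x y, adj x y -> c x != c y} /\
  forall k, exists2 x, adj u x & c x = k.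
Proof.
have [|c col_c] := @critical_coloring [set~ u].
  by apply/eqP=> /setP/(_ u); rewrite !inE eqxx.
exists c; split=> // k; case: (pickP [pred x | adj u x && (c x == k)]).
  by move=> x /andP[ux /eqP]; exists x.
move=> no_k.
case: (@critical_not_5colorable (fun x => if x == u then k else c x)).
have kP x : adj u x -> k != c x.
  by move=> ux; have /= := no_k x; rewrite ux eq_sym => /negbT.
move=> x y /=; case: (eqVneq x u) => [->|xu]; case: (eqVneq y u) => [->|yu].
- by rewrite adj_irrefl.
- exact: kP.
- by rewrite adj_sym eq_sym; apply: kP.
- by apply: col_c; rewrite !inE.
Qed.
End Critical.

(** * Soundness of the search *)

Section Search.
Variable G : sgraph.

Fixpoint realizes (H : seq (seq bool)) (xs : seq G) : bool :=
  match H, xs with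
  | [::], [::] => true
  | t :: H', x :: xs' =>
      [&& t == [seq adj x z | z <- xs'], x \notin xs' & realizes H' xs']
  | _, _ => false
  end.

Lemma realizes_size H xs : realizes H xs -> size xs = size H.
Proof. by elim: H xs => [|t H IHH] [|x xs] //= /and3P[_ _ /IHH->]. Qed.

Lemma realizes_edge x0 H xs i j : realizes H xs -> i < size H -> j < size H ->
  edge H i j = adj (nth x0 xs i) (nth x0 xs j).
Proof.
elim: H xs i j => [|t H IHH] [|x xs] //= i j /and3P[/eqP-> _ Hxs].
have sz := realizes_size Hxs.
case: i j => [|i] [|j] //=; rewrite ?adj_irrefl ?ltnS // => *.
- by rewrite (nth_map x0) ?sz.
- by rewrite (nth_map x0) ?sz // adj_sym.
- exact: IHH.
Qed.

Lemma realizes_uniq H xs : realizes H xs -> uniq xs.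
Proof. by elim: H xs => [|t H IHH] [|x xs] //= /and3P[_ -> /IHH]. Qed.

Hypotheses (P6f : ~ contains G (path_graph 6)) (diaf : ~ contains G diamond).
Hypothesis omega4 : clique_number G <= 4.

Lemma induced_path_map (e : rel nat) (f : nat -> G) (p : seq nat) :
  {in p &, forall i j, e i j = adj (f i) (f j)} ->
  induced_path e p -> induced_path (@adj G) (map f p).
Proof.
elim: p => //= i q IHq ef /andP[iq path_q].
rewrite IHq ?andbT //; last first.
  by move=> j k jq kq; apply: ef; rewrite in_cons ?jq ?kq orbT.
case: q ef iq {IHq path_q} => [|j r] //= ef /andP[ij /allP ir].
rewrite -ef ?inE ?eqxx ?orbT // ij; apply/allP=> _ /mapP[k kr ->].
by rewrite -ef ?ir // !inE ?eqxx ?kr ?orbT.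
Qed.

Lemma realizes_not_bad H xs : realizes H xs -> ~~ bad H.
Proof.
case: H xs => [|t H] [|x xs] // Hxs; apply/negP; rewrite /bad.
set V := iota 1 _; pose f := nth x (x :: xs).
have VE i : (i \in 0 :: V) = (i < size (t :: H)).
  by rewrite (_ : 0 :: V = iota 0 (size H).+1) // mem_iota.
have ef : {in 0 :: V &, forall i j, edge (t :: H) i j = adj (f i) (f j)}.
  by move=> i j; rewrite !VE; apply: realizes_edge.
have ef_in (p : seq nat) : {subset p <= 0 :: V} ->
    {in p &, forall i j, edge (t :: H) i j = adj (f i) (f j)}.
  by move=> pV i j /pV iV /pV; apply: ef.
case/or3P.
- case/(diamond_atP (@edge_sym _))=> [|a [b [c [d]]]]; first by rewrite mem_iota.
  move=> [sV [ab aNb cd /and4P[ac ad bc bd]]].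
  have [aV bV cV dV] : 
      [/\ a \in 0 :: V, b \in 0 :: V, c \in 0 :: V & d \in 0 :: V].
    by split; apply: sV; rewrite !inE eqxx ?orbT.
  move: aNb cd ac ad bc bd; rewrite !ef // => aNb cd ac ad bc bd.
  case/negP: aNb; apply: (diamond_free_adj diaf _ cd ac ad bc bd).
  rewrite /f nth_uniq ?(realizes_size Hxs) -?VE //.
  exact: realizes_uniq Hxs.
(* Four pairwise adjacent neighbours of the newest vertex form a K5 with it. *)
- case/clique_in_pairwise=> q [sz_q qV cl_q].
  have q0V : {subset 0 :: q <= 0 :: V}.
    move=> i; rewrite !in_cons => /predU1P[->|/qV]; first by rewrite eqxx.
    by rewrite mem_filter => /andP[_ ->]; rewrite orbT.
  have : pairwise (edge (t :: H)) (0 :: q).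
    rewrite pairwise_cons cl_q andbT; apply/allP=> i /qV.
    by rewrite mem_filter => /andP[].
  move=> cl_0q; have : pairwise (relpre f (@adj G)) (0 :: q).
    move: cl_0q; apply: (@sub_in_pairwise _ (mem (0 :: q))); last by apply/allP.
    by move=> i j iq jq; rewrite /= -(ef_in _ q0V).
  rewrite -pairwise_map => /pairwise_clique; rewrite size_map /= sz_q.
  by move=> /leq_trans/(_ omega4).
- case/(path6_atP (@edge_sym _))=> p [sz_p pV].
  move=> /(induced_path_map (ef_in p pV)); apply/negP.
  by apply: P6_free_path; rewrite ?size_map.
Qed.

Definition nbrs_type (xs : seq G) (y : G) : seq bool := [seq adj y x | x <- xs].

Definition outside_types (xs : seq G) (ext : seq (seq bool)) : Prop :=
  forall y, y \notin xs -> nbrs_type xs y \in ext.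

Lemma realizes_cons H xs x : realizes H xs -> x \notin xs ->
  realizes (nbrs_type xs x :: H) (x :: xs).
Proof. by move=> Hxs xxs; rewrite /= eqxx xxs. Qed.

(** The filter in [next] loses no type that occurs: [y :: x :: xs] lies in [G], so its code is not
    bad. *)
Lemma outside_types_next H xs ext x : realizes H xs -> x \notin xs ->
  outside_types xs ext ->
  outside_types (x :: xs) (next (nbrs_type xs x) H ext).
Proof.
move=> Hxs xxs out y yxs; have := yxs; rewrite in_cons negb_or => /andP[_ yx].
rewrite mem_filter (realizes_not_bad (realizes_cons (realizes_cons Hxs xxs) yxs)).
apply/allpairsP; exists (nbrs_type xs y, adj y x).
by split=> //; [apply: out | case: adj].
Qed.

Hypothesis critG : vertex_critical 6 G.

Lemma realizes_row x0 H xs i : realizes H xs -> i < size H ->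
  row H i = [seq adj (nth x0 xs i) x | x <- xs].
Proof.
move=> Hxs iH; rewrite /row -(realizes_size Hxs).
rewrite -[X in _ = map _ X](mkseq_nth x0) -map_comp; apply/eq_in_map=> j.
rewrite mem_iota /= => jxs.
by apply: realizes_edge; rewrite // -(realizes_size Hxs).
Qed.

Lemma nth_nbrs_type x0 xs y i : i < size xs ->
  nth false (nbrs_type xs y) i = adj (nth x0 xs i) y.
Proof. by move=> ixs; rewrite (nth_map x0) // adj_sym. Qed.

(** Colour [G] minus [u] so that all five colours occur on the neighbours of [u]. Then [u] has at
    least five neighbours. Moreover, a neighbour of [u] with the colour of [v] is not adjacent to
    [v], so it lies outside [H] if [v] dominates [u] there. *)
Lemma demand_met H xs ext D : realizes H xs -> outside_types xs ext ->
  D \in demands H ext -> exists2 x, x \notin xs & nbrs_type xs x \in D.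
Proof.
move=> Hxs out; have sz := realizes_size Hxs.
(* [x0] serves as default for [nth]. If [G] is empty, so is [H], which makes no demand. *)
have [x0 _ | noG] := pickP G; last first.
  by case: xs sz {Hxs out} => [/esym/size0nil-> // | x xs]; have := noG x.
rewrite mem_cat => /orP[/mapP[i] | /allpairsPdep[i [j []]]].
  rewrite mem_filter mem_iota => /andP[deg_i /= iH] ->{D}.
  case: (pickP [pred x | (x \notin xs) && adj (nth x0 xs i) x]) => [x|no_x].
    move=> /andP[xxs ix]; exists x => //.
    by rewrite mem_filter (nth_nbrs_type x0) ?sz // ix out.
  have [c [_ c_onto]] := critical_recolor critG (nth x0 xs i).
  have : size (enum 'I_5) <= size [seq c x | x <- xs & adj (nth x0 xs i) x].
    apply: uniq_leq_size (enum_uniq _) _ => k _.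
    have [x ix <-] := c_onto k; apply: map_f; rewrite mem_filter ix /=.
    by have /= := no_x x; rewrite ix andbT => /negbFE.
  rewrite size_map size_enum_ord size_filter leqNgt; case/negP.
  by move: deg_i; rewrite (realizes_row x0 Hxs iH) count_map.
rewrite mem_filter !mem_iota /= => iH /andP[/and3P[ijN ij dom] jH] ->{D}.
have adj_ij : ~~ adj (nth x0 xs i) (nth x0 xs j).
  by rewrite -(realizes_edge x0 Hxs).
have {}dom x : x \in xs -> adj (nth x0 xs i) x -> adj (nth x0 xs j) x.
  move: dom; rewrite !(realizes_row x0 Hxs) // all2E zip_map all_map.
  by case/andP=> _ /allP/(_ x)/[apply]/implyP.
case: (pickP [pred x | [&& x \notin xs, adj (nth x0 xs i) x
                         & ~~ adj (nth x0 xs j) x]]).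
  move=> x /and3P[xxs ix jx]; exists x => //.
  by rewrite mem_filter !(nth_nbrs_type x0) ?sz // ix jx out.
move=> no_x; have [c [col_c /(_ (c (nth x0 xs j)))[x ix cx]]] :=
  critical_recolor critG (nth x0 xs i).
have jx : adj (nth x0 xs j) x.
  have := no_x x; rewrite /= ix /=.
  by case: (boolP (x \in xs)) => [/dom->|_ /negbFE].
have : c (nth x0 xs j) != c x; last by rewrite cx eqxx.
apply: col_c jx; rewrite !inE.
  rewrite nth_uniq ?sz // 1?eq_sym //; exact: realizes_uniq Hxs.
by apply: contraTneq ix => ->; rewrite adj_irrefl.
Qed.

Definition item (xs : seq G) (z : G) : nat + seq bool :=
  if z \in xs then inl (index z xs) else inr (nbrs_type xs z).

Lemma conflict_adj H xs x y : realizes H xs -> adj x y ->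
  conflict H (item xs x) (item xs y).
Proof.
move=> Hxs xy; have sz := realizes_size Hxs.
have index_H z : z \in xs -> index z xs < size H by rewrite -sz index_mem.
have type_index z w : z \in xs -> adj z w ->
    nth false (nbrs_type xs w) (index z xs).
  by move=> zxs zw; rewrite (nth_nbrs_type z) ?index_mem // nth_index.
rewrite /item; case: ifPn => xxs; case: ifPn => yxs /=.
- by rewrite (realizes_edge x Hxs) ?index_H // !nth_index.
- exact: type_index.
- by apply: type_index; rewrite // adj_sym.
have xy_xs : x \notin y :: xs.
  rewrite in_cons negb_or xxs andbT.
  by apply: contraTneq xy => ->; rewrite adj_irrefl.
(* The bit [true] becomes [adj x y], which turns the first row into the type of [x] over
   [y :: xs]. *)
rewrite -{1}xy.
exact: realizes_not_bad (realizes_cons (realizes_cons Hxs yxs) xy_xs).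
Qed.

Lemma closes_sound H xs ext :
  realizes H xs -> outside_types xs ext -> ~~ closes H ext.
Proof.
move=> Hxs out; have sz := realizes_size Hxs.
apply/negP=> /and4P[H0 /allP no_self /allP no_zero].
case/colour_fun=> phi [phi5 col_phi].
(* The outside vertices of empty type. As [H] is nonempty, [A] is a proper subset and criticality
   colours it. *)
pose A := [set x | (x \notin xs) && ~~ has id (nbrs_type xs x)].
have [|psi col_psi] := critical_coloring critG (A := A).
  case: xs sz @A {Hxs out} H0 => [<- // | x xs] _ A _.
  by apply/eqP=> /setP/(_ x); rewrite !inE eqxx.
have item_mem z : z \notin A -> item xs z \in
    [seq inl i | i <- rev (iota 0 (size H))]
      ++ [seq inr t | t <- [seq t <- ext | has id t]].
  rewrite inE /item mem_cat; case: ifPn => [zxs _ | zxs /negPn has_z].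
    by rewrite map_f // mem_rev mem_iota /= -sz index_mem.
  by rewrite orbC map_f // mem_filter has_z out.
(* No edge leaves [A], so the colourings of [A] and of the rest can be combined freely. *)
have AE x y : adj x y -> x \in A -> y \in A.
  rewrite adj_sym !inE => yx /andP[xxs no_x].
  case: (boolP (y \in xs)) => [yxs | yxs /=].
    case/hasP: no_x; exists true => //.
    by apply/mapP; exists y; rewrite 1?adj_sym ?yx.
  apply/negP=> has_y.
  have /no_zero/negP[] : nbrs_type xs y \in [seq t <- ext | has id t].
    by rewrite mem_filter has_y out.
  have := conflict_adj Hxs yx; rewrite /item (negPf yxs) (negPf xxs).
  suff -> : nbrs_type xs x = nseq (size H) false by [].
  rewrite -sz -(size_map (fun z => adj x z)); apply/all_pred1P.
  by move: no_x; rewrite -all_predC; apply: sub_all => -[].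
pose c z : 'I_5 := if z \in A then psi z else inord (phi (item xs z)).
apply: (critical_not_5colorable critG (c := c)) => x y xy; rewrite /c.
case: ifPn => [xA | xA]; first by rewrite (AE _ _ xy xA) col_psi // (AE _ _ xy).
rewrite ifN; last by apply: contra xA; apply: AE; rewrite adj_sym.
have yA : y \notin A by apply: contra xA; apply: AE; rewrite adj_sym.
have : phi (item xs x) != phi (item xs y).
  apply: col_phi; rewrite ?item_mem //; last first.
  - by apply: conflict_adj; rewrite // adj_sym.
  - exact: conflict_adj.
  (* Adjacent vertices have distinct items, as a common item would conflict with itself. *)
  apply: contraTneq (conflict_adj Hxs xy) => ->; move: yA.
  rewrite /item inE; case: ifPn => [_ _ | yxs /negPn has_y].
    by rewrite /= edge_irrefl.
  by apply: no_self; rewrite mem_filter has_y out.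
apply: contraNneq => /(congr1 (@nat_of_ord 5)).
by rewrite !inordK ?phi5 ?item_mem // => ->.
Qed.

(** Either an outside vertex has type [s] and can join [H], or [s] can be struck off the possible
    types. Exhausted fuel yields [false], so it never certifies anything. *)
Lemma search_sound fuel H xs ext :
  realizes H xs -> outside_types xs ext -> ~~ search fuel H ext.
Proof.
elim: fuel H xs ext => [|f IHf] H xs ext Hxs out //=.
set ds := sort _ _.
have ds_met D : D \in ds -> exists2 x, x \notin xs & nbrs_type xs x \in D.
  by rewrite mem_sort; apply: demand_met.
case: ds ds_met => [_|D ds /(_ D (mem_head _ _))]; first exact: closes_sound Hxs _.
case: D => [[] | s D _]; first by [].
case: ifP => // search_s.
case: (pickP [pred x | (x \notin xs) && (nbrs_type xs x == s)]) => [x | no_s].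
  case/andP=> xxs /eqP xs_s; move: search_s; apply/contraTT => _; rewrite -xs_s.
  by apply: (IHf _ (x :: xs));
    [apply: realizes_cons | apply: outside_types_next].
apply: IHf Hxs _ => y yxs; rewrite mem_filter out // andbT.
by have /= := no_s y; rewrite yxs => /negbT.
Qed.

(** The clique is grown by the same rule as in the search, from the empty graph, over which every
    vertex has type [[::]]. *)
Lemma clique_rows_sound (q : seq G) : pairwise (@adj G) q ->
  realizes (clique_rows (size q)) q /\ outside_types q (clique_types (size q)).
Proof.
elim: q => [|x q IHq] /=; first by split=> // y _; rewrite mem_head.
move=> /andP[xq /IHq[realq outq]].
have typeE : nbrs_type q x = nseq (size q) true.
  rewrite -(size_map (fun z => adj x z)); apply/all_pred1P; rewrite all_map.
  by apply: sub_all xq => z /= ->.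
have x_q : x \notin q.
  by apply: contraTN xq => xq; apply/allPn; exists x; rewrite ?adj_irrefl.
rewrite -typeE; split; last exact: outside_types_next.
exact: realizes_cons realq x_q.
Qed.

End Search.

(** * The computation and the conclusion *)

Lemma search_K4 : search 100 (clique_rows 4) (clique_types 4).
Proof. by vm_compute. Qed.

Theorem theorem10 :
  ~ exists G : sgraph,
      [/\ vertex_critical 6 G,
          free [:: path_graph 6; diamond] G
        & clique_number G = 4].
Proof.
move=> [G [critG freeG omegaG]].
have P6f : ~ contains G (path_graph 6) by apply: List.Forall_inv freeG.
have diaf : ~ contains G diamond.
  exact: List.Forall_inv (List.Forall_inv_tail freeG).
have [q sz_q cl_q] := clique_number_pairwise G.
have omega4 : clique_number G <= 4 by rewrite omegaG.
have := clique_rows_sound P6f diaf omega4 cl_q.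
rewrite sz_q omegaG => -[realq outq].
case/negP: (search_sound P6f diaf omega4 critG 100 realq outq).
exact: search_K4.
Qed.
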